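(* Let $n$ be a positive integer, $T>0$, $A\in\mathbb{R}^{n\times n}$ and $B\in\mathbb{R}^{n\times 1}$. Suppose that the pair $(A,B)$ is controllable and the matrix $A$ is nonsingular. Then the value function $V(\xi)=\min_{u\in\mathcal{U}(\xi)}\|u\|_0$ of the maximum hands-off control problem is strictly convex on the reachable set $\mathcal{R}$.
   Context: Consider the linear time-invariant system $\dot{x}(t)=Ax(t)+Bu(t)$, with state $x(t)\in\mathbb{R}^n$ and scalar control $u(t)\in\mathbb{R}$, on the time interval $[0,T]$. For a measurable function $u:[0,T]\to\mathbb{R}$ define $\|u\|_\infty=\sup_{t\in[0,T]}|u(t)|$ and $\|u\|_0=m(\mathrm{supp}(u))$, where $\mathrm{supp}(u)$ is the closure of $\{t\in[0,T]:u(t)\neq 0\}$ and $m$ is Lebesgue measure on $\mathbb{R}$. For an initial state $\xi\in\mathbb{R}^n$, the set of admissible controls (those steering $x(0)=\xi$ to $x(T)=0$ with magnitude at most $1$) is $$\mathcal{U}(\xi)=\Bigl\{u\in L^1:\int_0^T e^{-As}Bu(s)\,ds=-\xi,\ \|u\|_\infty\le 1\Bigr\}.$$ The value function is $V(\xi)=\min_{u\in\mathcal{U}(\xi)}\|u\|_0$. The reachable set is the convex set $$\mathcal{R}=\Bigl\{\int_0^T e^{-As}Bu(s)\,ds:\|u\|_\infty\le 1\Bigr\}\subset\mathbb{R}^n.$$ A real-valued function $f$ on a convex set $\mathcal{C}\subset\mathbb{R}^n$ is strictly convex if $f((1-\lambda)x+\lambda y)<(1-\lambda)f(x)+\lambda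 f(y)$ for all distinct $x,y\in\mathcal{C}$ and all $\lambda\in(0,1)$. *)

(* Defs.v *)
From HB Require Import structures.
From mathcomp Require Import all_boot all_order all_algebra.
From mathcomp Require Import all_classical all_reals all_analysis.
Set Implicit Arguments.
Unset Strict Implicit.
Unset Printing Implicit Defensive.
Import Order.TTheory GRing.Theory Num.Theory.
Import numFieldNormedType.Exports.
Local Open Scope classical_set_scope.
Local Open Scope ring_scope.

(* [lim] is total with a junk value, but this series converges for every [M]. *)
Definition expmx (R : realType) (n : nat) (M : 'M[R]_n) : 'M[R]_n :=
  limn (series (fun k : nat => (k`!%:R)^-1 *: (M ^+ k))).

Definition strictly_convex_on (R : realType) (E : lmodType R)
    (C : set E) (f : E -> R) : Prop :=
  forall x y : E, C x -> C y -> x <> y ->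
  forall l : R, 0 < l -> l < 1 ->
    f ((1 - l) *: x + l *: y) < (1 - l) * f x + l * f y.

Section Controls.
Context {R : realType}.
Implicit Types (T : R) (u : R -> R).

(* A control on [0, T] is a function R -> R of which only the restriction to
   [0, T] is ever used. *)
Definition is_L1 T u : Prop :=
  (@lebesgue_measure R).-integrable `[0, T] (EFin \o u).

(* A pointwise (not essential) supremum, extended-real valued so that it is
   +oo, and not the junk value of [sup], when u is unbounded. *)
Definition norm_inf T u : \bar R :=
  ereal_sup [set `|u t|%:E | t in `[0, T]].

Definition supp T u : set R :=
  closure [set t | t \in `[0, T] /\ u t != 0].

(* [fine] loses nothing: supp T u is a subset of [0, T]. *)
Definition norm0 T u : R := fine (@lebesgue_measure R (supp T u)).

End Controls.

Section LTI.
Context {R : realType} {n : nat}.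
Variables (A : 'M[R]_n) (B : 'cV[R]_n).
Implicit Types (T : R) (u : R -> R) (xi : 'cV[R]_n).

(* \int_0^T e^{-As} B u(s) ds, computed entrywise *)
Definition input_integral T u : 'cV[R]_n :=
  \col_(i < n) (\int[@lebesgue_measure R]_(s in `[0%R, T])
                  ((expmx ((- s) *: A) *m B) i ord0 * u s))%R.

(* The solution at time t of x' = A x + B u with x(0) = xi, by variation of
   constants. *)
Definition state xi u (t : R) : 'cV[R]_n :=
  expmx (t *: A) *m (xi + input_integral t u).

(* Every state can be steered to every other one in some finite time, with no
   bound on the control. *)
Definition controllable : Prop :=
  forall x0 x1 : 'cV[R]_n, exists t : R, 0 < t /\
    exists u, is_L1 t u /\ state x0 u t = x1.

Definition admissible T xi : set (R -> R) :=
  [set u | [/\ is_L1 T u, input_integral T u = - xi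
             & (norm_inf T u <= 1%:E)%E]].

Definition reachable T : set 'cV[R]_n :=
  [set input_integral T u | u in
    [set u | measurable_fun `[0, T] u /\ (norm_inf T u <= 1%:E)%E]].

(* Infimum of a set of nonnegative reals. It is junk only when the set is empty,
   i.e. when xi is not reachable (the reachable set is symmetric). *)
Definition value T xi : R := inf [set norm0 T u | u in admissible T xi].

End LTI.

(* Main.v *)
(* Since |u| <= 1, the L1 norm of an admissible control is a lower bound for its
   L0 norm. Separating the optimal cost v at xi from the epigraph of the L1 cost
   yields multipliers (a, p) <> 0 with a >= 0 such that every admissible control
   with L1 norm close to v nearly minimizes int (p phi u + a |u|), where
   phi(s) = e^{-sA} B. This functional is minimized pointwise by a bang-off-bang
   control b, and its excess over the minimum is at least
   int | |p phi| - a | |u - b|. By controllability and nonsingularity of A the set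
   {|p phi| = a} is countable, so L1-minimizing sequences converge to b in L1, and b
   is optimal for both norms, with equal values. If strict convexity failed
   between x and y, optimal controls for x and y would both minimize the
   functional attached to the intermediate point, hence agree a.e., and x = y. *)
Require Import Defs.
From HB Require Import structures.
From mathcomp Require Import all_boot all_order all_algebra.
From mathcomp Require Import all_classical all_reals all_analysis.
From mathcomp Require Import measurable_realfun ring lra.
Set Implicit Arguments.
Unset Strict Implicit.
Unset Printing Implicit Defensive.
Import Order.TTheory GRing.Theory Num.Theory.
Import numFieldNormedType.Exports.
Local Open Scope classical_set_scope.
Local Open Scope ring_scope.

(** * Separation of the origin from a convex set in finite dimension *)

Section Separation.
Context {R : realType}.

(** Vectors are tested against row vectors [p], so that convergence, derivatives and integrals of
    matrix expressions reduce to real ones. *)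
Definition rdot m (p : 'rV[R]_m) (x : 'cV[R]_m) : R := (p *m x) ord0 ord0.

Lemma rdotD m (p : 'rV[R]_m) x y : rdot p (x + y) = rdot p x + rdot p y.
Proof. by rewrite /rdot mulmxDr mxE. Qed.

Lemma rdotZ m (p : 'rV[R]_m) a x : rdot p (a *: x) = a * rdot p x.
Proof. by rewrite /rdot -scalemxAr mxE. Qed.

Lemma rdotN m (p : 'rV[R]_m) x : rdot p (- x) = - rdot p x.
Proof. by rewrite -scaleN1r rdotZ mulN1r. Qed.

Lemma rdotM m k (p : 'rV[R]_m) (M : 'M[R]_(m, k)) x :
  rdot p (M *m x) = rdot (p *m M) x.
Proof. by rewrite /rdot mulmxA. Qed.

Lemma rdot_delta m k (M : 'M[R]_(m, k)) i j :
  rdot (delta_mx 0 i) (M *m delta_mx j 0) = M i j.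
Proof. by rewrite /rdot mulmxA -rowE -colE !mxE. Qed.

Lemma rdot_row_col m (a : R) (p : 'rV[R]_m) (s : R) (x : 'cV[R]_m) :
  rdot (row_mx a%:M p) (col_mx s%:M x) = a * s + rdot p x.
Proof. by rewrite /rdot mul_row_col mxE -scalar_mxM mxE eqxx mulr1n. Qed.

Lemma rdotE m (p : 'rV[R]_m) x : rdot p x = \sum_i p ord0 i * x i ord0.
Proof. by rewrite /rdot mxE. Qed.

Definition convex_subset (E : lmodType R) (C : set E) : Prop :=
  forall x y, C x -> C y -> forall l : R, 0 <= l -> l <= 1 ->
  C ((1 - l) *: x + l *: y).

(* Induction on the dimension. A functional p' that is nonnegative on the slice
   {(0, x) in C} extends to (a, p') for any a between the suprema of - p' x / s
   over s > 0 and the infimum over s < 0; these are ordered because the segment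
   from (s, x) to (- t, y) crosses the slice. *)
Lemma convex_separation m (C : set 'cV[R]_m) :
  convex_subset C -> C !=set0 -> ~ C 0 ->
  exists2 p : 'rV[R]_m, p != 0 & forall x, C x -> 0 <= rdot p x.
Proof.
elim: m C => [|m IH] C cC [x0 Cx0] C0.
  by case: C0; rewrite (_ : 0 = x0)//; apply/matrixP => -[].
pose D s := [set x : 'cV[R]_m | C (col_mx (s%:M : 'M[R]_1) x : 'cV_(1 + m))].
have CE (z : 'cV[R]_m.+1) : C z -> exists s x,
    (z = col_mx (s%:M : 'M[R]_1) x :> 'cV_(1 + m)) /\ D s x.
  move=> Cz; exists (z ord0 ord0), (dsubmx (z : 'cV_(1 + m))).
  have zE : z = col_mx ((z ord0 ord0)%:M : 'M[R]_1) (dsubmx (z : 'cV_(1 + m)))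
      :> 'cV_(1 + m).
    rewrite -[LHS](@vsubmxK _ 1 m); congr col_mx.
    apply/matrixP => i j; rewrite !ord1 !mxE eqxx mulr1n.
    by congr (z _ _); apply/val_inj.
  by split=> //; rewrite /D/= -zE.
have Dconv s t x y l : D s x -> D t y -> 0 <= l -> l <= 1 ->
    D ((1 - l) * s + l * t) ((1 - l) *: x + l *: y).
  move=> Dx Dy l0 l1; have : C ((1 - l) *: (col_mx s%:M x : 'cV_(1 + m)) +
      l *: (col_mx t%:M y : 'cV_(1 + m))) by exact: cC.
  by rewrite !scale_col_mx add_col_mx !scale_scalar_mx -raddfD.
have cross s t x y : 0 < s -> 0 < t -> D s x -> D (- t) y ->
    D 0 ((s + t)^-1 *: (t *: x + s *: y)).
  move=> s0 t0 Dx Dy; have st0 : 0 < s + t by exact: addr_gt0.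
  have := @Dconv _ _ _ _ (s / (s + t)) Dx Dy.
  rewrite divr_ge0 ?(ltW s0) ?(ltW st0)// ler_pdivrMr// mul1r lerDl ltW//.
  move=> /(_ isT isT).
  have -> : 1 - s / (s + t) = t / (s + t) by field; rewrite gt_eqF.
  rewrite (_ : t / (s + t) * s + s / (s + t) * - t = 0); last first.
    by field; rewrite gt_eqF.
  by rewrite scalerDr !scalerA mulrC (mulrC _ s).
(* If the first coordinate does not take both signs on [C], it separates by itself, up to sign. *)
have [[s [x [s0 Dx]]]|noP] := pselect (exists s x, 0 < s /\ (D s x)); last first.
  exists (row_mx (-1)%:M 0 : 'rV_(1 + m)).
    apply/eqP => /(congr1 (fun p : 'rV_m.+1 => p ord0 ord0)); rewrite !mxE.
    case: splitP => // j _; rewrite !ord1 !mxE eqxx mulr1n => /eqP.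
    by rewrite oppr_eq0 oner_eq0.
  move=> z /CE[s [x [-> Dx]]]; rewrite rdot_row_col /rdot mul0mx mxE addr0.
  rewrite mulN1r oppr_ge0 leNgt; apply/negP => s0; apply: noP; by exists s, x.
have [[t [y [t0 Dy]]]|noN] := pselect (exists t x, 0 < t /\ D (- t) x); last first.
  exists (row_mx 1%:M 0 : 'rV_(1 + m)).
    apply/eqP => /(congr1 (fun p : 'rV_m.+1 => p ord0 ord0)); rewrite !mxE.
    case: splitP => // j _; rewrite !ord1 !mxE eqxx mulr1n => /eqP.
    by rewrite oner_eq0.
  move=> z /CE[t [y [-> Dy]]]; rewrite rdot_row_col /rdot mul0mx mxE addr0.
  rewrite mul1r leNgt; apply/negP => t0; apply: noN; exists (- t), y.
  by rewrite oppr_gt0 opprK.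
have [] := IH (D 0).
- move=> x1 y1 Dx1 Dy1 l l0 l1; have := Dconv _ _ _ _ _ Dx1 Dy1 l0 l1.
  by rewrite !mulr0 addr0.
- by eexists; exact: (cross s t x y).
- by rewrite /D/= (_ : 0%:M = 0) ?col_mx0// raddf0.
move=> p p0 pD.
have key s1 t1 x1 y1 : 0 < s1 -> 0 < t1 -> D s1 x1 -> D (- t1) y1 ->
    - rdot p x1 / s1 <= rdot p y1 / t1.
  move=> s10 t10 Dx1 Dy1.
  have := pD _ (cross _ _ _ _ s10 t10 Dx1 Dy1).
  rewrite rdotZ rdotD !rdotZ pmulr_rge0 ?invr_gt0 ?addr_gt0//.
  rewrite ler_pdivlMr// mulrAC ler_pdivrMr//; lra.
pose S := [set a | exists s1 x1, [/\ 0 < s1, D s1 x1 & a = - rdot p x1 / s1]].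
have Sub t1 y1 : 0 < t1 -> D (- t1) y1 -> ubound S (rdot p y1 / t1).
  by move=> t10 Dy1 _ [s1 [x1 [s10 Dx1 ->]]]; exact: key.
have S0 : S !=set0 by exists (- rdot p x / s), s, x.
exists (row_mx (sup S)%:M p : 'rV_(1 + m)).
  apply: contra p0 => /eqP/(congr1 (fun q : 'rV_(1 + m) => rsubmx q)).
  by rewrite row_mxKr raddf0 => ->.
move=> z /CE[s1 [x1 [-> Dx1]]]; rewrite rdot_row_col.
have [s10|s10|s10] := ltrgt0P s1.
- have : - rdot p x1 / s1 <= sup S.
    apply: ub_le_sup; last by exists s1, x1.
    by eexists; exact: Sub t0 Dy.
  by rewrite ler_pdivrMr//; lra.
- have : sup S <= rdot p x1 / (- s1).
    by apply: ge_sup => //; apply: Sub; rewrite ?oppr_gt0// opprK.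
  by rewrite ler_pdivlMr ?oppr_gt0//; lra.
- by rewrite s10 mulr0 add0r; apply: pD; rewrite -s10.
Qed.

End Separation.

(** * Matrix exponential as an entrywise power series *)

Lemma cvg_sumr {R : numFieldType} {V : normedModType R} {I : finType} {T : Type}
    (F : set_system T) (f : I -> T -> V) (a : I -> V) : Filter F ->
  (forall i, f i x @[x --> F] --> a i) ->
  \sum_i f i x @[x --> F] --> \sum_i a i.
Proof. by move=> FF fa; apply: cvg_big => //; exact: add_continuous. Qed.

Section MatrixExponential.
Context {R : realType} {n : nat}.
Implicit Types (A M : 'M[R]_n) (p : 'rV[R]_n) (B : 'cV[R]_n) (x : R).

(** Coefficients of the power series of p e^{xA} B in x; the scalar theory then provides convergence
    and derivatives. *)
Definition expmx_coef A p B (k : nat) : R := (k`!%:R)^-1 * rdot p (A ^+ k *m B).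

(** Differentiation cancels k + 1 against the factorial and leaves one more factor A, which is moved
    onto [B]. *)
Lemma expmx_coef_diffs A p B :
  pseries_diffs (expmx_coef A p B) = expmx_coef A p (A *m B).
Proof.
apply/funext => k; rewrite /pseries_diffs /expmx_coef exprSr.
by rewrite -mulmxE mulmxA mulrA factS natrM invfM mulVKf// pnatr_eq0.
Qed.

Lemma expmx_coef_mull A p B : expmx_coef A p (A *m B) = expmx_coef A (p *m A) B.
Proof.
apply/funext => k; congr (_ * _); rewrite /rdot !mulmxA; congr ((_ *m _) _ _).
by rewrite -!mulmxA; congr (_ *m _); rewrite mulmxE -exprSr exprS.
Qed.

(** The sum of all absolute entries dominates every absolute row sum, so each multiplication by A
    costs at most this factor. *)
Lemma norm_expmx_entry_le A k i j :
  `|(A ^+ k) i j| <= (\sum_a \sum_b `|A a b|) ^+ k.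
Proof.
set c := \sum_a _.
have c0 : 0 <= c by apply: sumr_ge0 => a _; exact: sumr_ge0.
elim: k i j => [|k IH] i j.
  by rewrite !expr0 mxE; case: eqP => _; rewrite ?normr1// normr0.
rewrite exprS -mulmxE mxE (le_trans (ler_norm_sum _ _ _))// exprS.
apply: (@le_trans _ _ (\sum_a `|A i a| * c ^+ k)).
  by apply: ler_sum => a _; rewrite normrM ler_wpM2l.
rewrite -mulr_suml ler_wpM2r ?exprn_ge0//.
rewrite /c [leRHS](bigD1 i)//= lerDl; apply: sumr_ge0 => a _; exact: sumr_ge0.
Qed.

Lemma is_cvg_expmx_pseries A p B x : cvgn (pseries (expmx_coef A p B) x).
Proof.
set c := \sum_a \sum_b `|A a b|.
pose C := \sum_i \sum_j `|p ord0 i| * `|B j ord0|.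
have c0 : 0 <= c by apply: sumr_ge0 => a _; exact: sumr_ge0.
apply: normed_cvg.
apply: (@series_le_cvg _ _ (C *: exp_coeff (c * `|x|))).
- by move=> k /=.
- move=> k; apply: mulr_ge0.
    by apply: sumr_ge0 => i _; apply: sumr_ge0 => j _; rewrite mulr_ge0.
  by rewrite exp_coeff_ge0 // mulr_ge0.
- move=> k; have -> : (C *: exp_coeff (c * `|x|)) k = C * ((c * `|x|) ^+ k / k`!%:R) by [].
  rewrite /= /expmx_coef.
  rewrite !normrM normrX exprMn ger0_norm ?invr_ge0//.
  suff dle : `|rdot p (A ^+ k *m B)| <= C * c ^+ k.
    rewrite (_ : C * _ = k`!%:R^-1 * (C * c ^+ k) * `|x| ^+ k).
      by rewrite ler_wpM2r ?exprn_ge0// ler_wpM2l ?invr_ge0.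
    by ring.
  rewrite rdotE (le_trans (ler_norm_sum _ _ _))// mulr_suml.
  apply: ler_sum => i _; rewrite normrM mxE mulr_suml.
  under [leRHS]eq_bigr do rewrite -mulrA.
  rewrite -mulr_sumr ler_wpM2l// (le_trans (ler_norm_sum _ _ _))//.
  apply: ler_sum => j _; rewrite normrM mulrC ler_wpM2l//.
  exact: norm_expmx_entry_le.
- by apply: is_cvg_seriesZ; exact: is_cvg_series_exp_coeff.
Qed.

Lemma rdot_mul_sum p M B :
  rdot p (M *m B) = \sum_i \sum_j p ord0 i * M i j * B j ord0.
Proof.
rewrite rdotE; apply: eq_bigr => i _; rewrite mxE mulr_sumr.
by apply: eq_bigr => j _; rewrite mulrA.
Qed.

Lemma cvg_rdot_mul {T : Type} (F : set_system T) (FF : Filter F)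
    (f : T -> 'M[R]_n) p M B :
  f @ F --> M -> rdot p (f x *m B) @[x --> F] --> rdot p (M *m B).
Proof.
move=> fM; rewrite rdot_mul_sum.
under eq_fun do rewrite rdot_mul_sum.
apply: cvg_sumr => i; apply: cvg_sumr => j.
apply: cvgMr_tmp; apply: cvgMl_tmp.
exact: (cvg_comp _ _ fM (@coord_continuous R n n i j M)).
Qed.

Lemma is_cvg_expmx M : cvgn (series (fun k => (k`!%:R)^-1 *: M ^+ k)).
Proof.
set u := series _.
have uE i j : (fun k => u k i j) = pseries (expmx_coef M (delta_mx 0 i) (delta_mx j 0)) 1.
  apply/funext => k; rewrite /u /pseries !seriesEnat /= summxE; apply: eq_bigr => l _.
  by rewrite /= expr1n mulr1 /expmx_coef mxE rdot_delta.
have -> : u = (fun k => \sum_i \sum_j u k i j *: delta_mx i j).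
  by apply/funext => k; exact: matrix_sum_delta.
apply/cvg_ex; eexists.
apply: cvg_sumr => i.
apply: cvg_sumr => j.
by apply: cvgZr_tmp; rewrite uE; exact: is_cvg_expmx_pseries.
Qed.

Lemma exprZmx A x k : (x *: A) ^+ k = x ^+ k *: A ^+ k.
Proof.
elim: k => [|k IH]; first by rewrite !expr0 scale1r.
by rewrite !exprS IH -!mulmxE -scalemxAl -scalemxAr scalerA.
Qed.

Lemma rdot_expmx A p B x :
  rdot p (expmx (x *: A) *m B) = limn (pseries (expmx_coef A p B) x).
Proof.
apply/esym/cvg_lim => //.
have -> : pseries (expmx_coef A p B) x =
    (fun M => rdot p (M *m B)) \o series (fun k => (k`!%:R)^-1 *: (x *: A) ^+ k).
  apply/funext => k; rewrite /pseries !seriesEnat /= mulmx_suml.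
  elim/big_rec2: _ => [|l y z _ ->]; first by rewrite /rdot mulmx0 mxE.
  rewrite rdotD -scalemxAl rdotZ /expmx_coef exprZmx; congr (_ + _).
  by rewrite -scalemxAl rdotZ; ring.
by apply: cvg_rdot_mul; exact: is_cvg_expmx.
Qed.

Lemma is_derive_expmx A p B x :
  is_derive x (1 : R) (fun x => rdot p (expmx (x *: A) *m B))
    (rdot p (expmx (x *: A) *m (A *m B))).
Proof.
rewrite rdot_expmx -expmx_coef_diffs.
rewrite (_ : (fun x => _) = fun x => limn (pseries (expmx_coef A p B) x)); last first.
  by apply/funext => y; exact: rdot_expmx.
(* The series and its first two formal derivatives converge everywhere, so any radius larger than
   |x| serves. *)
apply: (@pseries_snd_diffs _ _ (`|x| + 1)); rewrite ?expmx_coef_diffs.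
- exact: is_cvg_expmx_pseries.
- exact: is_cvg_expmx_pseries.
- exact: is_cvg_expmx_pseries.
- by rewrite [ltRHS]ger0_norm ?ltrDl// addr_ge0.
Qed.

Lemma rdot_expmx_comm A p B x :
  rdot p (expmx (x *: A) *m (A *m B)) = rdot (p *m A) (expmx (x *: A) *m B).
Proof. by rewrite !rdot_expmx expmx_coef_mull. Qed.

Lemma rdot_expmx_eq0 A p B x :
  (forall k, rdot p (A ^+ k *m B) = 0) -> rdot p (expmx (x *: A) *m B) = 0.
Proof.
move=> p0; rewrite rdot_expmx; apply/cvg_lim => //.
rewrite (_ : pseries _ _ = cst 0); first exact: cvg_cst.
apply/funext => k; rewrite /pseries seriesEnat /= big1// => l _.
by rewrite /expmx_coef p0 mulr0 mul0r.
Qed.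

End MatrixExponential.

(** * Countable zero sets from nonvanishing derivatives *)

Section AnalyticZeros.
Context {R : realType}.

Lemma isolated_zero (f : R -> R) (x df : R) :
  is_derive x (1 : R) f df -> f x = 0 -> df != 0 -> isolated [set y | f y = 0] x.
Proof.
move=> [fx dfE] fx0 df0; split; first by rewrite inE.
have : h^-1 *: (f (h *: 1 + x) - f x) @[h --> 0^'] --> df by rewrite -dfE.
move=> /cvgr_neq0 - /(_ df0); rewrite near_withinE /= => nz.
move/nbhs_ballP : nz => [e /= e0 nz].
exists (ball x e); first exact: nbhsx_ballx.
apply/seteqP; split => y /=; last by move=> ->; split; [exact: ballxx|].
move=> [xye fy]; apply/eqP; apply: contraT; rewrite -subr_eq0 => yx.
have /nz/(_ yx) : ball 0 e (y - x).
  by move: xye; rewrite /ball/= sub0r opprB.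
by rewrite [_ *: 1]mulr1 subrK fy fx0 subr0 scaler0 eqxx.
Qed.

(** [g] lists the successive derivatives of a function. If k is the least order with [g k x]
    nonzero, a zero x of [g 0] is an isolated zero of the derivative of order k - 1, and a set of
    reals has only countably many isolated points. *)
Lemma countable_zeros (g : nat -> R -> R) :
    (forall k x, is_derive x (1 : R) (g k) (g k.+1 x)) ->
    (forall x, exists k, g k x != 0) ->
  countable [set x | g 0%N x = 0].
Proof.
move=> dg g0.
apply: (@sub_countable _ _ _ (\bigcup_k isolated [set x | g k x = 0])).
  apply: subset_card_le => x /= gx0.
  have [k gk kmin] := ex_minnP (g0 x).
  case: k gk kmin => [|k] gk kmin; first by rewrite gx0 eqxx in gk.
  have gkx : g k x = 0 by apply/eqP; apply: contraT => /kmin; rewrite ltnn.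
  by exists k => //; exact: (isolated_zero (dg k x) gkx gk).
by apply: bigcup_countable => // k _; exact: countable_isolated.
Qed.

End AnalyticZeros.

(** * The inverse of the matrix exponential *)

Section ExponentialGroup.
Context {R : realType} {n : nat}.
Implicit Types (A M : 'M[R]_n) (p : 'rV[R]_n) (B : 'cV[R]_n) (x : R).

Lemma expmx0 A : expmx (0 *: A) = 1%:M.
Proof.
apply/matrixP => i j.
(* The partial sum of length 0 is empty; all later ones equal the constant term. *)
rewrite -rdot_delta rdot_expmx; apply/cvg_lim => //; rewrite -cvg_shiftS.
apply: cvg_near_cst; apply: nearW => k /=.
rewrite /pseries seriesEnat /= big_nat_recl// big1 ?addr0; last first.
  by move=> l _; rewrite expr0n mulr0.
by rewrite expr0 mulr1 /expmx_coef fact0 invr1 mul1r expr0 rdot_delta.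
Qed.

Lemma rdot_mul_delta p M B :
  \sum_k rdot p (M *m delta_mx k 0) * rdot (delta_mx 0 k) B = rdot p (M *m B).
Proof.
rewrite /rdot [in RHS]mulmxA [in RHS]mxE; apply: eq_bigr => k _.
by rewrite mulmxA -colE -rowE !mxE.
Qed.

Lemma is_derive_expmxN A p B x :
  is_derive x (1 : R) (fun x => rdot p (expmx ((- x) *: A) *m B))
    (- rdot p (expmx ((- x) *: A) *m (A *m B))).
Proof.
have dN : is_derive x (1 : R) (-%R : R -> R) (-1).
  by apply: is_derive_eq; rewrite ?scaleN1r.
rewrite -mulrN1; exact: (is_derive1_comp (is_derive_expmx A p B (- x)) dN).
Qed.

(** The function p e^{tA} e^{-tA} B of t has derivative zero by the product rule, since A commutes
    with its exponential, and equals p B at t = 0. *)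
Lemma expmxVr A x : expmx (x *: A) *m expmx ((- x) *: A) = 1%:M.
Proof.
have E0 y z p B : rdot p (expmx (y *: A) *m (expmx ((- y) *: A) *m B)) =
              rdot p (expmx (z *: A) *m (expmx ((- z) *: A) *m B)).
  pose f (k : 'I_n) y := rdot p (expmx (y *: A) *m delta_mx k 0).
  pose g (k : 'I_n) y := rdot (delta_mx 0 k) (expmx ((- y) *: A) *m B).
  have fgE t : (\sum_k (f k * g k)) t =
      rdot p (expmx (t *: A) *m (expmx ((- t) *: A) *m B)).
    by rewrite fct_sumE -[RHS]rdot_mul_delta.
  rewrite -!fgE; apply: is_derive_0_is_cst => t.
  have df k : is_derive t (1 : R) (f k) (rdot p (expmx (t *: A) *m (A *m delta_mx k 0))).
    exact: is_derive_expmx.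
  have dg k : is_derive t (1 : R) (g k)
      (- rdot (delta_mx 0 k) (expmx ((- t) *: A) *m (A *m B))).
    exact: is_derive_expmxN.
  apply: is_derive_eq.
  rewrite big_split/=; under eq_bigr do rewrite /GRing.scale/= mulrN.
  under [X in _ + X]eq_bigr do rewrite /GRing.scale/= mulrC mulmxA.
  rewrite sumrN /f /g !rdot_mul_delta -mulmxA.
  by rewrite !(rdotM p) rdot_expmx_comm (rdotM _ A) addNr.
apply/matrixP => i j; rewrite -[LHS]rdot_delta -[RHS]rdot_delta -mulmxA (E0 x 0).
by rewrite oppr0 expmx0 !mul1mx.
Qed.

End ExponentialGroup.

(** * Bounded measurable functions on a set of finite measure *)

Section BoundedMeasurable.
Context d {X : measurableType d} {R : realType}.
Variables (mu : {measure set X -> \bar R}) (D : set X).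
Hypotheses (mD : measurable D) (muD : (mu D < +oo)%E).
Implicit Types f g : X -> R.

(** A class closed under the operations used below and, [mu D] being finite, contained in the
    integrable functions; it discharges the integrability conditions. *)
Definition bmeas f : Prop :=
  measurable_fun D f /\ exists M : R, forall s, D s -> `|f s| <= M.

Lemma bmeas_cst r : bmeas (fun=> r).
Proof. by split; [exact: measurable_cst|exists `|r|]. Qed.

Lemma bmeasD f g : bmeas f -> bmeas g -> bmeas (fun s => f s + g s).
Proof.
move=> [mf [M fM]] [mg [N gN]]; split; first exact: measurable_funD.
by exists (M + N) => s Ds; rewrite (le_trans (ler_normD _ _))// lerD ?fM ?gN.
Qed.

Lemma bmeasM f g : bmeas f -> bmeas g -> bmeas (fun s => f s * g s).
Proof.
move=> [mf [M fM]] [mg [N gN]]; split; first exact: measurable_funM.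
by exists (M * N) => s Ds; rewrite normrM ler_pM ?fM ?gN.
Qed.

Lemma bmeasZ r f : bmeas f -> bmeas (fun s => r * f s).
Proof. by apply: bmeasM; exact: bmeas_cst. Qed.

Lemma bmeasB f g : bmeas f -> bmeas g -> bmeas (fun s => f s - g s).
Proof.
move=> bf bg; rewrite (_ : (fun s => _) = fun s => f s + -1 * g s); last first.
  by apply/funext => s; rewrite mulN1r.
by apply: bmeasD => //; exact: bmeasZ.
Qed.

Lemma bmeas_norm f : bmeas f -> bmeas (fun s => `|f s|).
Proof.
move=> [mf [M fM]]; split; first exact: measurableT_comp.
by exists M => s Ds; rewrite normr_id fM.
Qed.

Lemma bmeas_max0 f : bmeas f -> bmeas (fun s => Num.max (f s) 0).
Proof.
move=> [mf [M fM]]; split; first by apply: measurable_maxr.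
exists `|M| => s Ds; have := fM s Ds; have := ler_norm M.
by case: (leP (f s) 0) => //; rewrite ?normr0//; lra.
Qed.

Lemma bmeas_sum (I : finType) (f : I -> X -> R) :
  (forall i, bmeas (f i)) -> bmeas (fun s => \sum_i f i s).
Proof.
move=> bf; rewrite (_ : (fun s => _) = \sum_i f i); last first.
  by apply/funext => s; rewrite fct_sumE.
by apply: big_ind => //; [exact: bmeas_cst|move=> *; exact: bmeasD].
Qed.

Lemma bmeas_integrable f : bmeas f -> mu.-integrable D (EFin \o f).
Proof.
move=> [mf [M fM]]; apply: measurable_bounded_integrable => //.
exists M; split; first exact: num_real.
by move=> N MN s Ds; exact: le_trans (fM s Ds) (ltW MN).
Qed.

Lemma bmeas_RintegralD f g : bmeas f -> bmeas g ->
  \int[mu]_(s in D) (f s + g s) = \int[mu]_(s in D) f s + \int[mu]_(s in D) g s.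
Proof. by move=> bf bg; apply: RintegralD => //; exact: bmeas_integrable. Qed.

Lemma bmeas_RintegralB f g : bmeas f -> bmeas g ->
  \int[mu]_(s in D) (f s - g s) = \int[mu]_(s in D) f s - \int[mu]_(s in D) g s.
Proof. by move=> bf bg; apply: RintegralB => //; exact: bmeas_integrable. Qed.

Lemma bmeas_RintegralZ r f : bmeas f ->
  \int[mu]_(s in D) (r * f s) = r * \int[mu]_(s in D) f s.
Proof. by move=> bf; apply: RintegralZl => //; exact: bmeas_integrable. Qed.

Lemma Rintegral_sum (I : finType) (f : I -> X -> R) :
  (forall i, mu.-integrable D (EFin \o f i)) ->
  \int[mu]_(s in D) (\sum_i f i s) = \sum_i \int[mu]_(s in D) f i s.
Proof.
move=> intf; elim: (index_enum I) => [|i r IH].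
  rewrite big_nil; under eq_Rintegral do rewrite big_nil.
  by rewrite Rintegral_cst// mul0r.
rewrite big_cons -IH -RintegralD//.
  by apply: eq_Rintegral => s _; rewrite big_cons.
rewrite (_ : (fun s => _) = \sum_(i <- r) f i); last first.
  by apply/funext => s; rewrite fct_sumE.
apply: (big_ind (fun g : X -> R => mu.-integrable D (EFin \o g))) => //.
  exact: bmeas_integrable (bmeas_cst 0).
by move=> g h ig ih; exact: (integrableD mD ig ih).
Qed.

Lemma bmeas_le_Rintegral f g : bmeas f -> bmeas g ->
  (forall s, D s -> f s <= g s) ->
  \int[mu]_(s in D) f s <= \int[mu]_(s in D) g s.
Proof. by move=> bf bg; apply: le_Rintegral => //; exact: bmeas_integrable. Qed.

Lemma bmeas_le_normr_Rintegral f : bmeas f ->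
  `|\int[mu]_(s in D) f s| <= \int[mu]_(s in D) `|f s|.
Proof. by move=> bf; apply: le_normr_Rintegral => //; exact: bmeas_integrable. Qed.

(** The truncations tend to 0 wherever [w] is positive, hence almost everywhere, and are dominated
    by 1. *)
Lemma Rintegral_truncation_cvg0 (w : X -> R) : bmeas w ->
  (forall s, D s -> 0 <= w s) -> mu (D `&` [set s | w s = 0]) = 0 ->
  (fun k : nat => \int[mu]_(s in D) Num.max (1 - k%:R * w s) 0) @ \oo --> (0 : R).
Proof.
move=> bw w0 muw0.
have bk (k : nat) : bmeas (fun s => Num.max (1 - k%:R * w s) 0).
  by apply: bmeas_max0; apply: bmeasB; [exact: bmeas_cst|exact: bmeasZ].
pose f k s := (Num.max (1 - k%:R * w s) 0)%:E.
have mw0 : measurable (D `&` [set s | w s = 0]).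
  by have := bw.1 mD _ (measurable_set1 0).
have [] := @dominated_convergence _ _ _ mu D mD f (cst 0%E) (cst 1%E).
- by move=> k; apply/measurable_EFinP; case: (bk k).
- exact: measurable_cst.
- exists (D `&` [set s | w s = 0]); split=> // s /= /not_implyP[Ds H].
  split=> //; apply: contrapT => ws0; apply: H.
  have {}ws0 : 0 < w s by rewrite lt_neqAle w0// eq_sym andbT; exact/eqP.
  apply: cvg_near_cst; near=> k; rewrite /f; congr EFin; apply/max_idPr.
  rewrite subr_le0 -ler_pdivrMr// div1r.
  by near: k; exact: nbhs_infty_ger.
- by have := bmeas_integrable (bmeas_cst 1); exact.
- apply: aeW => s k Ds; rewrite /f /= lee_fin ger0_norm; last by rewrite le_max lexx orbT.
  by rewrite ge_max ler01 andbT lerBlDr lerDl mulr_ge0// w0.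
move=> _ _; rewrite integral_cst// mul0e => /fine_cvg; exact.
Unshelve. all: by end_near. Qed.

(** Where k w >= 1 the weight controls |f|, and the rest contributes little because [w] vanishes
    only on a null set. The bound 2 is that of a difference of two controls with values in
    [-1, 1]. *)
Lemma weighted_L1_small (w : X -> R) : bmeas w ->
  (forall s, D s -> 0 <= w s) -> mu (D `&` [set s | w s = 0]) = 0 ->
  forall e : R, 0 < e -> exists2 eta : R, 0 < eta &
  forall f, bmeas f -> (forall s, D s -> `|f s| <= 2) ->
  \int[mu]_(s in D) (w s * `|f s|) <= eta -> \int[mu]_(s in D) `|f s| <= e.
Proof.
move=> bw w0 muw0 e e0.
have := Rintegral_truncation_cvg0 bw w0 muw0.
move=> /cvgrPdist_lt/(_ (e / 4)); rewrite divr_gt0// => /(_ isT)[k _ /(_ k (leqnn k))/=].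
rewrite sub0r normrN => Hk.
(* The truncation term will contribute at most 2 (e / 4) and the weighted term at most e / 2; k + 1
   instead of k keeps the denominator positive. *)
exists (e / (2 * k.+1%:R)); first by rewrite divr_gt0// mulr_gt0.
move=> f bf f2 wf.
have bk : bmeas (fun s => Num.max (1 - k%:R * w s) 0).
  by apply: bmeas_max0; apply: bmeasB; [exact: bmeas_cst|exact: bmeasZ].
have bwf : bmeas (fun s => w s * `|f s|) by apply: bmeasM => //; exact: bmeas_norm.
(* |f| <= k w |f| + 2 (1 - k w)^+ *)
apply: (@le_trans _ _ (\int[mu]_(s in D)
    (k%:R * (w s * `|f s|) + 2 * Num.max (1 - k%:R * w s) 0))).
  apply: bmeas_le_Rintegral; [exact: bmeas_norm|by apply: bmeasD; exact: bmeasZ|].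
  move=> s Ds; rewrite mulrA; have := f2 s Ds; have := normr_ge0 (f s).
  have : 0 <= k%:R * w s by rewrite mulr_ge0// w0.
  move: (k%:R * w s) `|f s| => a b a0 b0 b2.
  by case: (leP (1 - a) 0) => a1; nra.
rewrite bmeas_RintegralD; [|exact: bmeasZ|exact: bmeasZ].
rewrite !bmeas_RintegralZ//.
have : k%:R * (\int[mu]_(s in D) (w s * `|f s|)) <= e / 2.
  apply: (@le_trans _ _ (k%:R * (e / (2 * k.+1%:R)))); first by rewrite ler_wpM2l.
  rewrite mulrCA ler_pM2l// invfM mulrCA -[leRHS]mulr1 ler_pM2l//.
  by rewrite ler_pdivrMr// mul1r ler_nat.
have := ler_norm (\int[mu]_(s in D) Num.max (1 - k%:R * w s) 0); lra.
Qed.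

End BoundedMeasurable.

(** * L1-minimal controls for a bounded measurable kernel *)

Section L1Minimization.
Context d {X : measurableType d} {R : realType} {n : nat}.
Variables (mu : {measure set X -> \bar R}) (D : set X).
Hypotheses (mD : measurable D) (muD : (mu D < +oo)%E).
Variable phi : 'I_n -> X -> R.
Hypothesis bphi : forall i, bmeas D (phi i).
Implicit Types (a l : R) (u v : X -> R) (p : 'rV[R]_n) (xi : 'cV[R]_n).

Definition unit_control u : Prop :=
  measurable_fun D u /\ forall s, D s -> `|u s| <= 1.

Definition moment u : 'cV[R]_n := \col_i \int[mu]_(s in D) (phi i s * u s).

Definition L1cost u : R := \int[mu]_(s in D) `|u s|.

Definition controls_to xi : set (X -> R) :=
  [set u | unit_control u /\ moment u = xi].

Definition switching p (s : X) : R := \sum_i p ord0 i * phi i s.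

(* The pointwise minimizer over [-1, 1] of v |-> switching p s * v + a * `|v|. *)
Definition bang a p (s : X) : R :=
  if a < switching p s then -1 else if switching p s < - a then 1 else 0.

(** For a >= 0, zero exactly where the pointwise minimizer over [-1, 1] is not unique. *)
Definition gap a p (s : X) : R := `| `|switching p s| - a |.

(** On controls with a prescribed moment this is [a * L1cost u] plus a constant. *)
Definition lagrangian a p u : R := rdot p (moment u) + a * L1cost u.

Lemma unit_bmeas u : unit_control u -> bmeas D u.
Proof. by move=> [mu1 u1]; split=> //; exists 1. Qed.

Lemma unit_convex u v l : unit_control u -> unit_control v -> 0 <= l -> l <= 1 ->
  unit_control (fun s => (1 - l) * u s + l * v s).
Proof.
move=> uu uv l0 l1; split.
  apply: measurable_funD; apply: measurable_funM => //; first exact: uu.1.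
  exact: uv.1.
move=> s Ds; rewrite (le_trans (ler_normD _ _))// !normrM (ger0_norm l0) ger0_norm ?subr_ge0//.
have := uu.2 s Ds; have := uv.2 s Ds; nra.
Qed.

Lemma bmeas_switching p : bmeas D (switching p).
Proof. by apply: bmeas_sum => i; exact: bmeasZ. Qed.

Lemma bmeas_gap a p : bmeas D (gap a p).
Proof.
apply: bmeas_norm; apply: bmeasB; last exact: bmeas_cst.
by apply: bmeas_norm; exact: bmeas_switching.
Qed.

Lemma unit_bang a p : unit_control (bang a p).
Proof.
have [ms _] := bmeas_switching p; split; last first.
  move=> s _; rewrite /bang; case: ifP => _; first by rewrite normrN1.
  by case: ifP => _; rewrite ?normr1// normr0.
apply: measurable_fun_if => //; first exact: measurable_fun_ltr.
apply: measurable_fun_if => //.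
- by have := measurable_fun_ltr (measurable_cst a) ms; exact.
- by apply: measurable_funS (measurable_fun_ltr ms (measurable_cst (- a))) => // s [].
Qed.

Lemma moment_convex u v l : bmeas D u -> bmeas D v ->
  moment (fun s => (1 - l) * u s + l * v s) = (1 - l) *: moment u + l *: moment v.
Proof.
move=> bu bv; apply/matrixP => i j; rewrite !mxE.
rewrite -!(bmeas_RintegralZ mD muD); [|exact: bmeasM..].
rewrite -(bmeas_RintegralD mD muD); [|exact/bmeasZ/bmeasM..].
by apply: eq_Rintegral => s _; rewrite mulrDr !mulrA !(mulrC (phi i s)).
Qed.

Lemma L1cost_convex u v l : bmeas D u -> bmeas D v -> 0 <= l -> l <= 1 ->
  L1cost (fun s => (1 - l) * u s + l * v s) <= (1 - l) * L1cost u + l * L1cost v.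
Proof.
move=> bu bv l0 l1; have bu' := bmeas_norm bu; have bv' := bmeas_norm bv.
rewrite -!(bmeas_RintegralZ mD muD)// -(bmeas_RintegralD mD muD); [|exact: bmeasZ..].
apply: (bmeas_le_Rintegral mD muD).
- by apply: bmeas_norm; apply: bmeasD; exact: bmeasZ.
- by apply: bmeasD; exact: bmeasZ.
move=> s _; rewrite (le_trans (ler_normD _ _))// !normrM.
by rewrite (ger0_norm l0) ger0_norm ?subr_ge0.
Qed.

Lemma L1cost_ge0 u : 0 <= L1cost u.
Proof. exact: Rintegral_ge0. Qed.

Lemma L1cost_le u v : bmeas D u -> bmeas D v ->
  L1cost u <= L1cost v + L1cost (fun s => v s - u s).
Proof.
move=> bu bv; rewrite -(bmeas_RintegralD mD muD); last 2 first.
- exact: bmeas_norm.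
- by apply: bmeas_norm; exact: bmeasB.
apply: (bmeas_le_Rintegral mD muD).
- exact: bmeas_norm.
- by apply: bmeasD; apply: bmeas_norm => //; exact: bmeasB.
by move=> s _; have := ler_normB (v s) (v s - u s); rewrite subKr.
Qed.

(** One constant serves all coordinates; through it, L1 limits of controls inherit their moment. *)
Lemma moment_lipschitz : exists2 M : R, 0 <= M & forall i u v, bmeas D u -> bmeas D v ->
  `|moment u i ord0 - moment v i ord0| <= M * L1cost (fun s => u s - v s).
Proof.
have /choice[M phiM] : forall i, exists M : R, forall s, D s -> `|phi i s| <= M.
  by move=> i; case: (bphi i).
exists (\sum_i `|M i|); first exact: sumr_ge0.
move=> i u v bu bv; have buv := bmeasB bu bv.
rewrite !mxE -(bmeas_RintegralB mD muD); [|exact: bmeasM..].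
under eq_Rintegral do rewrite -mulrBr.
rewrite (le_trans (bmeas_le_normr_Rintegral mD muD _))//; first exact: bmeasM.
have bnuv := bmeas_norm buv.
rewrite -(bmeas_RintegralZ mD muD)//; apply: (bmeas_le_Rintegral mD muD).
- by apply: bmeas_norm; exact: bmeasM.
- exact: bmeasZ.
move=> s Ds; rewrite normrM ler_wpM2r// (le_trans (phiM i s Ds))//.
rewrite (le_trans (ler_norm _))// (bigD1 i)//= lerDl; exact: sumr_ge0.
Qed.

Lemma lagrangianE a p u : bmeas D u ->
  lagrangian a p u = \int[mu]_(s in D) (switching p s * u s + a * `|u s|).
Proof.
move=> bu; have bnu := bmeas_norm bu; have bsu : bmeas D (fun s => switching p s * u s).
  by apply: bmeasM => //; exact: bmeas_switching.
rewrite (bmeas_RintegralD mD muD)//; last exact: bmeasZ.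
rewrite (bmeas_RintegralZ mD muD)//; congr (_ + _).
rewrite rdotE; under eq_bigr do rewrite mxE -(bmeas_RintegralZ mD muD _ (bmeasM (bphi _) bu)).
rewrite -(Rintegral_sum mD muD); last first.
  by move=> i; apply: (bmeas_integrable mD muD); apply: bmeasZ; exact: bmeasM.
by apply: eq_Rintegral => s _; rewrite mulr_suml; apply: eq_bigr => i _; rewrite mulrA.
Qed.

(** With g the value of [switching p s], the convex function v |-> g v + a |v| on [-1, 1] grows away
    from its minimizer with slope at least | |g| - a |, in each of the three regimes of [bang]. *)
Lemma bang_gap a p u s : 0 <= a -> `|u s| <= 1 ->
  gap a p s * `|u s - bang a p s| <=
  (switching p s * u s + a * `|u s|) - (switching p s * bang a p s + a * `|bang a p s|).
Proof.
rewrite /gap /bang; move: (switching p s) (u s) => g v a0 /[dup] v1 /ler_normlP[v1' v1''].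
have [nv nv'] : - `|v| <= v /\ v <= `|v| by have := lexx `|v|; rewrite ler_norml => /andP[].
case: ifPn => [ag|]; last rewrite -leNgt => ga.
  rewrite normrN1 (ger0_norm (_ : 0 <= g)); last lra.
  rewrite (ger0_norm (_ : 0 <= g - a)); last lra.
  rewrite (ger0_norm (_ : 0 <= v - -1)); last lra.
  have av : 0 <= `|v| + v by lra.
  have := mulr_ge0 a0 av. lra.
case: ifPn => [ag|]; last rewrite -leNgt => ga'.
  rewrite normr1 (ler0_norm (_ : g <= 0)); last lra.
  rewrite (ger0_norm (_ : 0 <= - g - a)); last lra.
  rewrite (ler0_norm (_ : v - 1 <= 0)); last lra.
  have av : 0 <= `|v| - v by lra.
  have := mulr_ge0 a0 av. lra.
rewrite !(normr0, mulr0, subr0, addr0).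
have ga2 : `|g| <= a by rewrite ler_norml ga' ga.
rewrite ler0_norm ?subr_le0//.
have := ler_norm (- (g * v)); rewrite normrN normrM; lra.
Qed.

Lemma gap_le_lagrangian a p u : 0 <= a -> unit_control u ->
  \int[mu]_(s in D) (gap a p s * `|u s - bang a p s|) <=
  lagrangian a p u - lagrangian a p (bang a p).
Proof.
move=> a0 uu; have bu := unit_bmeas uu; have bb := unit_bmeas (unit_bang a p).
have bsw := bmeas_switching p.
have bL v : bmeas D v -> bmeas D (fun s => switching p s * v s + a * `|v s|).
  by move=> bv; apply: bmeasD; [exact: bmeasM|apply: bmeasZ; exact: bmeas_norm].
rewrite !lagrangianE// -(bmeas_RintegralB mD muD); [|exact: bL..].
apply: (bmeas_le_Rintegral mD muD).
- by apply: bmeasM; [exact: bmeas_gap|apply: bmeas_norm; exact: bmeasB].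
- by apply: bmeasB; exact: bL.
by move=> s Ds; apply: bang_gap => //; exact: uu.2.
Qed.

(** A normality condition: for no nontrivial multiplier is the pointwise minimizer undetermined on a
    set of positive measure. *)
Definition negligible_levels : Prop := forall a p, 0 <= a -> (a != 0) || (p != 0) ->
  mu (D `&` [set s | gap a p s = 0]) = 0.

(** The gap is a weight that vanishes only on a null set, and the distance to [bang a p] weighted by
    it is at most the excess of the Lagrangian. *)
Lemma L1_close_of_lagrangian a p : negligible_levels -> 0 <= a ->
    (a != 0) || (p != 0) ->
  forall e : R, 0 < e -> exists2 eta : R, 0 < eta & forall u, unit_control u ->
  lagrangian a p u <= lagrangian a p (bang a p) + eta ->
  L1cost (fun s => u s - bang a p s) <= e.
Proof.
move=> lev a0 ap0 e e0.
have g0 s : D s -> 0 <= gap a p s by move=> _; exact: normr_ge0.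
have [eta eta0 H] := weighted_L1_small mD muD (bmeas_gap a p) g0 (lev a p a0 ap0) e0.
have ub := unit_bang a p.
exists eta => // u uu Lu; apply: H.
- by apply: bmeasB; exact: unit_bmeas.
- by move=> s Ds; rewrite (le_trans (ler_normB _ _))//; have := uu.2 s Ds;
    have := ub.2 s Ds; lra.
- by have := gap_le_lagrangian p a0 uu; lra.
Qed.

(** Minimizers are within every positive distance of [bang a p] in L1, and the moment is Lipschitz
    for that distance. *)
Lemma lagrangian_minimizers_moment a p u v : negligible_levels -> 0 <= a ->
    (a != 0) || (p != 0) -> unit_control u -> unit_control v ->
    lagrangian a p u <= lagrangian a p (bang a p) ->
    lagrangian a p v <= lagrangian a p (bang a p) ->
  moment u = moment v.
Proof.
move=> lev a0 ap0.
suff H w : unit_control w -> lagrangian a p w <= lagrangian a p (bang a p) ->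
    moment w = moment (bang a p).
  by move=> uu uv /(H _ uu) -> /(H _ uv) ->.
move=> uw Lw; have [M M0 HM] := moment_lipschitz.
apply/matrixP => i j; rewrite ord1; apply/eqP.
rewrite -subr_eq0 -normr_eq0 eq_le normr_ge0 andbT; apply/ler_addgt0Pr => e e0.
have e'0 : 0 < e / (M + 1) by rewrite divr_gt0// ltr_wpDl.
have [eta eta0 /(_ w uw)] := L1_close_of_lagrangian lev a0 ap0 e'0.
move=> /(_ (le_trans Lw _)); rewrite lerDl => /(_ (ltW eta0)) wb.
rewrite add0r (le_trans (HM _ _ _ (unit_bmeas uw) (unit_bmeas (unit_bang a p))))//.
apply: (@le_trans _ _ (M * (e / (M + 1)))); first by rewrite ler_wpM2l.
by rewrite mulrCA ger_pMr// ler_pdivrMr ?ltr_wpDl// mul1r lerDl.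
Qed.

(* Separates the point (v, xi), v the infimum of the costs, from the epigraph of
   the cost over attainable moments; the multiplier a of the cost may vanish when
   xi is on the boundary of the attainable set. *)
Lemma multiplier_exists xi : controls_to xi !=set0 ->
  exists a p, [/\ 0 <= a, (a != 0) || (p != 0) & forall u, unit_control u ->
    a * inf [set L1cost u | u in controls_to xi] + rdot p xi <= lagrangian a p u].
Proof.
move=> [u0 [uu0 u0xi]]; set v := inf _.
pose pt r u : 'cV[R]_(1 + n) := col_mx (r - v)%:M (moment u - xi).
(* The inequality between cost and [r] is strict, so the origin stays outside [C] even if the
   infimum is attained. *)
pose C : set 'cV[R]_(1 + n) :=
  [set z | exists r u, [/\ unit_control u, L1cost u < r & z = pt r u]].
have [] := @convex_separation R _ C.
- move=> _ _ [r1 [u1 [uu1 r1u1 ->]]] [r2 [u2 [uu2 r2u2 ->]]] l l0 l1.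
  exists ((1 - l) * r1 + l * r2), (fun s => (1 - l) * u1 s + l * u2 s); split.
  + exact: unit_convex.
  + apply: (le_lt_trans (L1cost_convex (unit_bmeas uu1) (unit_bmeas uu2) l0 l1)).
    have [->|l_neq0] := eqVneq l 0; first by rewrite subr0 !mul1r !mul0r !addr0.
    have l_gt0 : 0 < l by rewrite lt_neqAle eq_sym l_neq0.
    by rewrite ler_ltD ?ler_wpM2l ?ltr_pM2l ?subr_ge0// ltW.
  + rewrite /pt moment_convex; [|exact: unit_bmeas..].
    rewrite !scale_col_mx add_col_mx !scale_scalar_mx -raddfD; congr col_mx.
      by congr (_ %:M); rewrite /=; ring.
    by apply/matrixP => i j; rewrite !mxE; ring.
- by exists (pt (L1cost u0 + 1) u0), (L1cost u0 + 1), u0; split=> //; rewrite ltrDl.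
- move=> [r [u [uu ru]]]; rewrite /pt -[0](@col_mx0 _ 1 n 1) => /eq_col_mx[rv uxi].
  have {}rv : r = v.
    move/matrixP : rv => /(_ 0 0); rewrite !mxE eqxx mulr1n => /esym/eqP.
    by rewrite subr_eq0 => /eqP.
  have : v <= L1cost u.
    apply: ge_inf; first by exists 0 => _ [w _ <-]; exact: L1cost_ge0.
    by exists u => //; split=> //; apply/eqP; rewrite -subr_eq0 -uxi.
  by rewrite leNgt -rv ru.
move=> q q0 qC; pose a := lsubmx (q : 'rV_(1 + n)) 0 0; pose p := rsubmx (q : 'rV_(1 + n)).
have qE : q = row_mx a%:M p :> 'rV_(1 + n).
  by rewrite -[LHS](@hsubmxK _ 1 1 n); congr row_mx; exact: mx11_scalar.
have key u r : unit_control u -> L1cost u < r ->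
    0 <= a * (r - v) + rdot p (moment u - xi).
  by move=> uu ru; rewrite -rdot_row_col -qE; apply: qC; exists r, u.
have a0 : 0 <= a.
  rewrite leNgt; apply/negP => alt0.
  pose c := rdot p (moment u0 - xi).
  (* For negative [a], the pairing a (r - v) + c is negative as soon as r exceeds its zero v + c /
     (- a). *)
  pose r := `|L1cost u0| + `|v + c / (- a)| + 1.
  have ru0 : L1cost u0 < r.
    by have := ler_norm (L1cost u0); have := normr_ge0 (v + c / (- a)); rewrite /r; lra.
  have := key u0 r uu0 ru0; rewrite -/c leNgt => /negP; apply.
  have : v + c / (- a) < r.
    by have := ler_norm (v + c / (- a)); have := normr_ge0 (L1cost u0); rewrite /r; lra.
  rewrite -ltrBrDl ltr_pdivrMr ?oppr_gt0//; lra.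
exists a, p; split => //.
  apply: contraNT q0; rewrite negb_or !negbK => /andP[/eqP a_eq0 /eqP p_eq0].
  by rewrite qE a_eq0 p_eq0 raddf0 row_mx0.
move=> u uu; apply/ler_addgt0Pr => e e0.
have e'0 : 0 < e / (a + 1) by rewrite divr_gt0// ltr_wpDl.
have := key u (L1cost u + e / (a + 1)) uu; rewrite ltrDl => /(_ e'0).
rewrite rdotD rdotN /lagrangian.
have : a * (e / (a + 1)) <= e.
  by rewrite mulrCA ger_pMr// ler_pdivrMr ?ltr_wpDl// mul1r lerDl.
rewrite mulrBr mulrDr; lra.
Qed.

(* A minimizing sequence is minimizing for the Lagrangian, hence converges in L1
   to its minimizer, so no weak compactness is needed. *)
Lemma bang_minimizes xi : negligible_levels -> controls_to xi !=set0 ->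
  exists a p, [/\ 0 <= a, (a != 0) || (p != 0), controls_to xi (bang a p) &
    forall u, controls_to xi u -> L1cost (bang a p) <= L1cost u].
Proof.
move=> lev xi0; have [a [p [a0 ap0 min]]] := multiplier_exists xi0.
exists a, p; set v := inf _ in min; set b := bang a p.
have ub : unit_control b by exact: unit_bang.
have hasinf : has_inf [set L1cost u | u in controls_to xi].
  split; first by case: xi0 => u uxi; exists (L1cost u), u.
  by exists 0 => _ [w _ <-]; exact: L1cost_ge0.
have approx e : 0 < e -> exists2 u, controls_to xi u &
    L1cost u <= v + e /\ L1cost (fun s => u s - b s) <= e.
  move=> e0; have [eta eta0 H] := L1_close_of_lagrangian lev a0 ap0 e0.
  (* A cost within e' of the infimum puts the Lagrangian at most a e' <= eta above its lower
     bound. *)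
  pose e' := Num.min e (eta / (a + 1)).
  have e'0 : 0 < e' by rewrite lt_min e0 divr_gt0// ltr_wpDl.
  have [_ [u uxi <-] uv] := inf_adherent e'0 hasinf.
  exists u => //; split; first by rewrite (le_trans (ltW uv))// lerD2l ge_min lexx.
  apply: H; first exact: uxi.1.
  apply: le_trans (_ : a * v + rdot p xi + eta <= _); last by rewrite lerD2r; exact: min.
  rewrite /lagrangian uxi.2.
  have : a * L1cost u <= a * (v + e') by rewrite ler_wpM2l// ltW.
  have : a * e' <= eta.
    apply: (@le_trans _ _ (a * (eta / (a + 1)))).
      by rewrite ler_wpM2l// ge_min lexx orbT.
    by rewrite mulrCA ger_pMr// ler_pdivrMr ?ltr_wpDl// mul1r lerDl.
  rewrite mulrDr; lra.
have [M M0 HM] := moment_lipschitz.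
split=> //; first split=> //.
  (* [b] has moment [xi], being an L1 limit of controls with that moment. *)
  apply/matrixP => i j; rewrite ord1; apply/esym/eqP.
  rewrite -subr_eq0 -normr_eq0 eq_le normr_ge0 andbT; apply/ler_addgt0Pr => e e0.
  have e'0 : 0 < e / (M + 1) by rewrite divr_gt0// ltr_wpDl.
  have [u [uu <-] [_ ub_e]] := approx _ e'0.
  rewrite add0r (le_trans (HM _ _ _ (unit_bmeas uu) (unit_bmeas ub)))//.
  apply: (@le_trans _ _ (M * (e / (M + 1)))); first by rewrite ler_wpM2l.
  by rewrite mulrCA ger_pMr// ler_pdivrMr ?ltr_wpDl// mul1r lerDl.
move=> u uxi; apply: (@le_trans _ _ v); last first.
  by apply: ge_inf; [exact: hasinf.2|exists u].
apply/ler_addgt0Pr => e e0; have e20 : 0 < e / 2 by rewrite divr_gt0.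
have [w [uw _] [wv wb]] := approx _ e20.
by have := L1cost_le (unit_bmeas ub) (unit_bmeas uw); lra.
Qed.

(** Otherwise the weighted mean of the Lagrangians at [u] and [v] would not exceed the minimum, as
    moments average exactly; both would be minimizers, with equal moments. *)
Lemma L1cost_strict_convex x y l u v w : negligible_levels ->
    0 < l -> l < 1 -> x <> y -> controls_to x u -> controls_to y v ->
    controls_to ((1 - l) *: x + l *: y) w ->
    (forall w', controls_to ((1 - l) *: x + l *: y) w' -> L1cost w <= L1cost w') ->
  L1cost w < (1 - l) * L1cost u + l * L1cost v.
Proof.
move=> lev l0 l1 xy ux vy wz wmin; rewrite ltNge; apply/negP => uvw.
have z0 : controls_to ((1 - l) *: x + l *: y) !=set0 by exists w.
have [a [p [a0 ap0 bz bmin]]] := bang_minimizes lev z0.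
have ub : unit_control (bang a p) by exact: unit_bang.
apply: xy; rewrite -ux.2 -vy.2.
have Lmin u' : unit_control u' -> lagrangian a p (bang a p) <= lagrangian a p u'.
  move=> uu'; rewrite -subr_ge0 (le_trans _ (gap_le_lagrangian p a0 uu'))//.
  by apply: Rintegral_ge0 => s _; exact: mulr_ge0 (normr_ge0 _) (normr_ge0 _).
have Lu := Lmin _ ux.1; have Lv := Lmin _ vy.1.
have Luv : (1 - l) * lagrangian a p u + l * lagrangian a p v <= lagrangian a p (bang a p).
  rewrite /lagrangian ux.2 vy.2 bz.2 rdotD !rdotZ.
  have := ler_wpM2l a0 (le_trans uvw (wmin _ bz)); rewrite mulrDr; lra.
by apply: (lagrangian_minimizers_moment lev a0 ap0 ux.1 vy.1); nra.
Qed.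

End L1Minimization.

(** * The kernel e^{-sA} B of the linear system *)

Definition impulse {R : realType} {n : nat} (A : 'M[R]_n) (B : 'cV[R]_n)
  (i : 'I_n) (s : measurableTypeR R) : R := (expmx ((- (s : R)) *: A) *m B) i ord0.

Section LTIControls.
Context {R : realType} {n : nat}.
Variables (A : 'M[R]_n) (B : 'cV[R]_n).
Implicit Types (T : R) (u : R -> R) (p : 'rV[R]_n) (xi : 'cV[R]_n).

Local Notation mu := (@lebesgue_measure R).
Local Notation phi := (impulse A B).

Local Notation seg T := (`[0%R, T]%classic : set (measurableTypeR R)).

Lemma measurable_segment T : measurable (seg T).
Proof. exact: measurable_itv. Qed.

Lemma lebesgue_segment_lty T : (mu (seg T) < +oo)%E.
Proof. by rewrite lebesgue_measure_itv/=; case: ifP => // _; rewrite -EFinB ltry. Qed.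

Lemma continuous_rdot_expmxN p : continuous (fun s : R => rdot p (expmx ((- s) *: A) *m B)).
Proof.
move=> s; apply: differentiable_continuous; apply/derivable1_diffP.
by have [] := is_derive_expmxN A p B s.
Qed.

Lemma phi_rdot i s : phi i s = rdot (delta_mx 0 i) (expmx ((- s) *: A) *m B).
Proof. by rewrite /impulse /rdot -rowE [RHS]mxE. Qed.

Lemma bmeas_phi T i : bmeas (seg T) (phi i).
Proof.
have cphi : continuous (phi i).
  rewrite (_ : phi i = fun s : R => rdot (delta_mx 0 i) (expmx ((- s) *: A) *m B)).
    exact: continuous_rdot_expmxN.
  by apply/funext => s; exact: phi_rdot.
split; first by apply: measurable_funTS; exact: continuous_measurable_fun.
have := compact_bounded
  (continuous_compact (continuous_subspaceT cphi) (@segment_compact _ 0 T)).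
move=> [M [_ HM]]; exists (M + 1) => s Ds; apply: (HM (M + 1)); first by rewrite ltrDl.
by exists s.
Qed.

(** Stated for integrable controls, because [controllable] allows unbounded ones; the kernel is
    bounded on the segment, so the products are integrable. *)
Lemma rdot_input_integral T u p : is_L1 T u ->
  rdot p (input_integral A B T u) =
  \int[mu]_(s in `[0, T]) (rdot p (expmx ((- s) *: A) *m B) * u s).
Proof.
move=> uL1.
have iphi i : mu.-integrable (seg T)
    (EFin \o (fun s : R => (expmx ((- s) *: A) *m B) i ord0 * u s)).
  have [mphi [M HM]] := bmeas_phi T i.
  have phi_bd : [bounded phi i s | s in `[0, T]%classic].
    exists M; split; first exact: num_real.
    by move=> N MN s Ds; exact: le_trans (HM s Ds) (ltW MN).
  have := integrableMr (measurable_segment T) mphi phi_bd uL1.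
  by apply: eq_integrable => // s _; rewrite /= EFinM.
rewrite rdotE; under eq_bigr do rewrite mxE -(RintegralZl _ (measurable_segment T) (iphi _)).
rewrite -(Rintegral_sum (measurable_segment T) (lebesgue_segment_lty T)).
  apply: eq_Rintegral => s _; rewrite rdotE mulr_suml.
  by apply: eq_bigr => i _; rewrite mulrA.
move=> i; have := integrableZl (measurable_segment T) (p ord0 i) (iphi i).
by apply: eq_integrable => [|s _]; [exact: measurable_segment|rewrite /= EFinM].
Qed.

Hypothesis AB_controllable : controllable A B.

Lemma expmxNK s M : expmx ((- s) *: A) *m (expmx (s *: A) *m M) = M :> 'cV[R]_n.
Proof. by rewrite mulmxA -{2}[s]opprK expmxVr mul1mx. Qed.

(** Such a [p] is blind to every control, so steering each basis vector to 0 shows that its entries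
    vanish. This stands in for the Kalman rank condition. *)
Lemma controllable_rdot_eq0 p :
  (forall s, rdot p (expmx (s *: A) *m B) = 0) -> p = 0.
Proof.
move=> p0; apply/rowP => j; rewrite [RHS]mxE.
have [t [t0 [u [uL1]]]] := AB_controllable (delta_mx j 0) 0.
rewrite /state => /(congr1 (mulmx (expmx ((- t) *: A)))).
rewrite expmxNK mulmx0 => /(congr1 (rdot p)).
rewrite rdotD rdot_input_integral//.
rewrite (_ : (fun s => _ * u s) = cst 0); last first.
  by apply/funext => s; rewrite p0 mul0r.
rewrite Rintegral_cst// mul0r addr0 /rdot mulmx0 -colE !mxE; exact.
Qed.

Hypothesis A_nonsingular : A \in unitmx.

Lemma expmx_unit s : expmx (s *: A) \in unitmx.
Proof. by case: (mulmx1_unit (expmxVr A s)). Qed.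

(* All derivatives of s |-> p e^{-sA} B - c vanish at s only if p e^{-sA} A is
   orthogonal to all A^k B; those of order 0 carry no information because of c,
   whence the factor A and the need for A to be nonsingular. *)
Lemma countable_switching_level p c : p != 0 ->
  countable [set s : R | rdot p (expmx ((- s) *: A) *m B) = c].
Proof.
move=> p0.
(* [g k] is the derivative of order k; the constant [c] survives at order 0 only. *)
pose g (k : nat) (s : R) : R := (-1) ^+ k * rdot p (expmx ((- s) *: A) *m (A ^+ k *m B)) -
  (if k is 0%N then c else 0).
have dg k s : is_derive s (1 : R) (g k) (g k.+1 s).
  have dh := is_derive_expmxN A p (A ^+ k *m B) s.
  have := is_deriveB (is_deriveZ ((-1) ^+ k) dh)
    (is_derive_cst (if k is 0%N then c else 0) s 1).
  move=> H; apply: (is_derive_eq H); rewrite /g !subr0 !exprS -mulmxE -mulmxA.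
  by rewrite /GRing.scale/= mulrN mulN1r mulNr.
have := countable_zeros dg; rewrite (_ : [set s | g 0%N s = 0] =
    [set s : R | rdot p (expmx ((- s) *: A) *m B) = c]); last first.
  apply/seteqP; split => s /=; rewrite /g expr0 mul1r expr0 mul1mx.
    by move=> /eqP; rewrite subr_eq0 => /eqP.
  by move=> ->; rewrite subrr.
apply => s; apply: contrapT => /forallNP gs0.
have w0 : p *m expmx ((- s) *: A) *m A = 0.
  apply: controllable_rdot_eq0 => t; apply: rdot_expmx_eq0 => k.
  have /negP/negPn := gs0 k.+1; rewrite /g subr0 mulf_eq0 signr_eq0/= => /eqP.
  by rewrite exprS -mulmxE -mulmxA !rdotM.
move/eqP : p0; apply.
have := congr1 (mulmx^~ (invmx A)) w0; rewrite mulmxK// mul0mx.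
move=> /(congr1 (mulmx^~ (invmx (expmx ((- s) *: A))))).
by rewrite mulmxK ?expmx_unit// mul0mx.
Qed.

(** * Equality of the L0 and L1 minima on [0, T] *)

Variable T : R.
Local Notation D := (seg T).

Lemma switchingE p s : switching phi p s = rdot p (expmx ((- s) *: A) *m B).
Proof. by rewrite rdotE. Qed.

(** For p = 0 the level set is empty, as a is then nonzero; otherwise it lies in the union of the
    level sets of p e^{-sA} B at a and - a, both countable. *)
Lemma LTI_negligible_levels : negligible_levels mu D phi.
Proof.
move=> a p a0 ap0; apply: countable_lebesgue_measure0.
have [p0|p_neq0] := eqVneq p 0.
  rewrite (_ : _ `&` _ = set0)//; apply/seteqP; split => // s [_ /=].
  rewrite /gap switchingE p0 /rdot mul0mx mxE normr0 sub0r normrN => /eqP.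
  by move: ap0; rewrite p0 eqxx orbF normr_eq0 => /negbTE ->.
apply: (@sub_countable _ _ _
    (\bigcup_(b in [set: bool])
       [set s : R | rdot p (expmx ((- s) *: A) *m B) = (-1) ^+ b * a])).
  apply: subset_card_le => s [_ /=]; rewrite /gap switchingE => /eqP.
  rewrite normr_eq0 subr_eq0 => /eqP <-.
  exists (rdot p (expmx ((- s) *: A) *m B) < 0)%R => //=.
  by rewrite [LHS]realEsign ?num_real.
by apply: bigcup_countable => // b _; exact: countable_switching_level.
Qed.

(** The supremum is pointwise, so it bounds [u] at every point of the segment, and a bounded
    measurable control is integrable there. *)
Lemma admissibleE xi u :
  admissible A B T xi u <-> controls_to mu D phi (- xi) u.
Proof.
split=> [[uL1 uxi u1]|[uu uxi]].
  split=> //; split; first by apply/measurable_EFinP; exact: measurable_int uL1.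
  move=> s Ds; rewrite -lee_fin; apply: le_trans u1.
  by apply: ereal_sup_ubound; exists s.
split=> //.
  exact: (bmeas_integrable (measurable_segment T) (lebesgue_segment_lty T) (unit_bmeas uu)).
by apply: ge_ereal_sup => _ [s Ds <-]; rewrite lee_fin uu.2.
Qed.

(** Negating a control negates its moment. *)
Lemma reachable_controls_to xi :
  reachable A B T xi -> controls_to mu D phi (- xi) !=set0.
Proof.
move=> [u [mu1 u1] uxi]; exists (fun s => -1 * u s).
have uu : unit_control D u.
  split=> // s Ds; rewrite -lee_fin; apply: le_trans u1.
  by apply: ereal_sup_ubound; exists s.
split.
  split; first exact: measurable_funM.
  by move=> s Ds; rewrite mulN1r normrN; exact: uu.2.
rewrite -uxi; apply/matrixP => i j; rewrite !mxE -[RHS]mulN1r.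
rewrite -(bmeas_RintegralZ (measurable_segment T) (lebesgue_segment_lty T)).
  by apply: eq_Rintegral => s _; rewrite mulrCA.
by apply: bmeasM; [exact: bmeas_phi|exact: unit_bmeas].
Qed.

Lemma supp_subset u : supp T u `<=` D.
Proof.
have cD : closed D by exact: itv_closed.
by rewrite [X in _ `<=` X](closure_id D).1//; apply: closure_subset => s [].
Qed.

Lemma measurable_supp u : measurable (supp T u).
Proof. by apply: closed_measurable; exact: closed_closure. Qed.

Lemma supp_lty u : (mu (supp T u) < +oo)%E.
Proof.
apply: le_lt_trans (lebesgue_segment_lty T).
apply: le_measure; rewrite ?inE; last exact: supp_subset.
  exact: measurable_supp.
exact: measurable_segment.
Qed.

(** On the segment, |u| is at most 1 on the support and zero off it. *)
Lemma L1cost_le_norm0 u : unit_control D u -> L1cost mu D u <= norm0 T u.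
Proof.
move=> uu.
have -> : norm0 T u = \int[mu]_(s in D) \1_(supp T u) s.
  rewrite /norm0 /Rintegral integral_indic//; last exact: measurable_supp.
  by congr (fine (mu _)); apply/esym/setIidPl; exact: supp_subset.
apply: le_Rintegral => //.
- apply: (bmeas_integrable (measurable_segment T) (lebesgue_segment_lty T)).
  exact: bmeas_norm (unit_bmeas uu).
- apply: (bmeas_integrable (measurable_segment T) (lebesgue_segment_lty T)).
  split; first by apply: measurable_indic; exact: measurable_supp.
  by exists 1 => s _; rewrite indicE; case: (_ \in _); rewrite ?normr1// normr0.
move=> s Ds; rewrite indicE; have [su|su] := boolP (s \in supp T u); first exact: uu.2.
suff -> : u s = 0 by rewrite normr0.
apply/eqP; apply: contraT => us0; move/negP : su; case; rewrite inE.
by apply: subset_closure; split.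
Qed.

(** The modulus of the bang-off-bang control is the indicator of {|switching| > a}. Its support lies
    in {|switching| >= a}, closed by continuity, and these sets differ by a null set: the closure in
    [supp] adds no measure. *)
Lemma norm0_bang_le a p : 0 <= a -> (a != 0) || (p != 0) ->
  norm0 T (bang phi a p) <= L1cost mu D (bang phi a p).
Proof.
move=> a0 ap0; set b := bang phi a p.
have cs : continuous (fun s => `|switching phi p s|).
  rewrite (_ : (fun s => _) = fun s : R => `|rdot p (expmx ((- s) *: A) *m B)|).
    by move=> s; apply: cvg_norm; exact: continuous_rdot_expmxN.
  by apply/funext => s; rewrite switchingE.
pose K := D `&` [set s | a <= `|switching phi p s|].
pose N := D `&` [set s | gap phi a p s = 0].
pose P := D `&` [set s | a < `|switching phi p s|].
have bE s : b s != 0 = (a < `|switching phi p s|).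
  rewrite ltr_normr ltrNr /b /bang; case: ifP => _; first by rewrite oppr_eq0 oner_eq0.
  by case: ifP => _; rewrite ?oner_eq0 ?eqxx.
have bnE s : `|b s| = (b s != 0)%:R.
  rewrite /b /bang; case: ifP => _; first by rewrite normrN1 oppr_eq0 oner_eq0.
  by case: ifP => _; rewrite ?normr1 ?oner_eq0 ?normr0 ?eqxx.
have suppK : supp T b `<=` K.
  have cK : closed K.
    apply: closedI; first exact: itv_closed.
    by apply: (closed_comp _ (@closed_ge _ a)) => s _; exact: cs.
  rewrite [X in _ `<=` X](closure_id K).1//; apply: closure_subset => s [Ds].
  by rewrite bE => /ltW as'; split.
have mD := measurable_segment T.
have msw := (bmeas_norm (bmeas_switching (bmeas_phi T) p)).1.
have mP : measurable P.
  rewrite /P (_ : [set s | _] = (fun s => `|switching phi p s|) @^-1` `]a, +oo[%classic).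
    by apply: msw => //; exact: measurable_itv.
  by apply/seteqP; split => s /=; rewrite in_itv/= andbT.
have mN : measurable N.
  have := (bmeas_gap (bmeas_phi T) a p).1 mD _ (measurable_set1 0).
  exact.
have -> : L1cost mu D b = fine (mu P).
  rewrite /L1cost (_ : P = P `&` D); last by apply/esym/setIidPl => s [].
  rewrite -integral_indic//; apply: eq_Rintegral => s; rewrite inE => Ds.
  rewrite bnE bE indicE; congr (_%:R); congr nat_of_bool.
  by apply/idP/idP; rewrite inE /P; [split|case].
have muP : (mu P < +oo)%E.
  apply: le_lt_trans (lebesgue_segment_lty T).
  by apply: le_measure; rewrite ?inE// => s [].
rewrite /norm0 fine_le//.
- by rewrite ge0_fin_numE// supp_lty.
- by rewrite ge0_fin_numE.
rewrite -[leRHS]adde0 -(LTI_negligible_levels a0 ap0) -/N.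
apply: le_trans (measureU2 _ mP mN).
apply: le_measure; rewrite ?inE; [exact: measurable_supp|exact: measurableU|].
move=> s /suppK[Ds]; rewrite /= le_eqVlt => /orP[/eqP as'|]; last by left.
by right; split=> //; rewrite /= /gap -as' subrr normr0.
Qed.

(** For admissible u, [norm0 T b] <= [L1cost b] <= [L1cost u] <= [norm0 T u], so b is optimal for
    both costs; taking u = b makes its two costs equal. *)
Lemma value_bang xi : controls_to mu D phi (- xi) !=set0 ->
  exists b, [/\ controls_to mu D phi (- xi) b,
    forall u, controls_to mu D phi (- xi) u -> L1cost mu D b <= L1cost mu D u,
    norm0 T b = value A B T xi & L1cost mu D b = value A B T xi].
Proof.
move=> xi0.
have [a [p [a0 ap0 bxi bmin]]] := bang_minimizes (measurable_segment T)
  (lebesgue_segment_lty T) (bmeas_phi T) LTI_negligible_levels xi0.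
have b0 := norm0_bang_le a0 ap0; set b := bang _ _ _ in bxi bmin b0.
have b1 := L1cost_le_norm0 bxi.1.
have lb u : admissible A B T xi u -> norm0 T b <= norm0 T u.
  move=> /admissibleE uxi; rewrite (le_trans b0)// (le_trans (bmin _ uxi))//.
  exact: L1cost_le_norm0 uxi.1.
have bE : norm0 T b = value A B T xi.
  apply/eqP; rewrite eq_le; apply/andP; split.
    apply: lb_le_inf; last by move=> _ [u uxi <-]; exact: lb.
    by exists (norm0 T b), b => //; apply/admissibleE.
  apply: ge_inf; first by exists (norm0 T b) => _ [u uxi <-]; exact: lb.
  by exists b => //; apply/admissibleE.
by exists b; split=> //; rewrite -bE; apply/eqP; rewrite eq_le b1 b0.
Qed.

End LTIControls.

(* The first conjunct says that the infimum defining [value] is a minimum. *)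
Theorem theorem7 (R : realType) (n : nat) (n_gt0 : (0 < n)%N)
    (T : R) (T_gt0 : 0 < T) (A : 'M[R]_n) (B : 'cV[R]_n)
    (AB_controllable : controllable A B) (A_nonsingular : A \in unitmx) :
  (forall xi : 'cV[R]_n, reachable A B T xi ->
     exists2 u : R -> R, admissible A B T xi u & norm0 T u = value A B T xi) /\
  strictly_convex_on (reachable A B T) (value A B T).
Proof.
split=> [xi /reachable_controls_to/value_bang|x y].
  move=> /(_ AB_controllable A_nonsingular)[b [bxi _ bE _]].
  by exists b => //; apply/admissibleE.
(* Both values become L1 costs of optimal controls, for which the strict inequality is available. *)
move=> /reachable_controls_to/value_bang - /(_ AB_controllable A_nonsingular)[u [ux _ _ <-]].
move=> /reachable_controls_to/value_bang - /(_ AB_controllable A_nonsingular)[v [vy _ _ <-]].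
move=> xy l l0 l1.
have mD := @measurable_segment R T.
have zE : - ((1 - l) *: x + l *: y) = (1 - l) *: (- x) + l *: (- y).
  by rewrite !scalerN opprD.
have z0 : controls_to (@lebesgue_measure R) `[0, T] (impulse A B)
    (- ((1 - l) *: x + l *: y)) !=set0.
  (* The convex combination of the two optimal controls serves the intermediate point. *)
  exists (fun s => (1 - l) * u s + l * v s); split.
    exact: (unit_convex ux.1 vy.1 (ltW l0) (ltW l1)).
  rewrite (moment_convex mD (lebesgue_segment_lty _)) ?ux.2 ?vy.2 ?zE//.
  - exact: bmeas_phi.
  - exact: unit_bmeas ux.1.
  - exact: unit_bmeas vy.1.
have [w [wz wmin _ <-]] := value_bang AB_controllable A_nonsingular z0.
rewrite zE in wz wmin.
apply: (L1cost_strict_convex mD (lebesgue_segment_lty _) (@bmeas_phi _ _ A B T)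
  (LTI_negligible_levels AB_controllable A_nonsingular T) l0 l1 _ ux vy wz wmin).
by move=> /oppr_inj.
Qed.
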